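(* Let $q$ be an odd prime power, $n\ge3$ an odd integer and $s$ an integer with $\gcd(s,2n)=1$. Let $\gamma\in\mathbb{F}_{q^{2n}}$ be such that $\mathrm{N}_{q^{2n}/q}(\gamma)$ is a non-square in $\mathbb{F}_q$. Then $$\tilde{\mathcal{H}}_s=\Big\{bx^{q^{2s\frac{n+1}{2}}}+a\gamma x^{q^{2s\frac{n-1}{2}}}+(a\gamma)^{q^{s(n+2)}}x^{q^{2s\frac{n+3}{2}}}+\sum_{i=1}^{\frac{n-3}{2}}\Big(c_ix^{q^{2si}}+c_i^{q^{s(2n-2i+1)}}x^{q^{2s(n-i+1)}}\Big): a,b\in\mathbb{F}_{q^n},\ c_i\in\mathbb{F}_{q^{2n}}\Big\}$$ is a maximum Hermitian $\mathbb{F}_q$-linear $2$-code; that is, it is an $\mathbb{F}_q$-linear set of size $q^{n(n-1)}$ every nonzero element of which has rank at least $2$.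
   Context: Polynomials are linearized polynomials over $\mathbb{F}_{q^{2n}}$ taken modulo $x^{q^{2n}}-x$, regarded as $\mathbb{F}_{q^2}$-linear maps $\mathbb{F}_{q^{2n}}\to\mathbb{F}_{q^{2n}}$; the rank of such $f$ is the $\mathbb{F}_{q^2}$-dimension of its image. $\mathrm{N}_{q^{2n}/q}(x)=x^{(q^{2n}-1)/(q-1)}$. For an additive Hermitian $2$-code the size is at most $q^{n(n-1)}$, so size $q^{n(n-1)}$ is maximum. *)

(* Defs.v *)
From HB Require Import structures.
From mathcomp Require Import all_boot all_order all_algebra all_field.
Unset Strict Implicit. Unset Printing Implicit Defensive.
Import GRing.Theory.
Local Open Scope ring_scope.

Section Defs.
Variable F : finFieldType.

Definition subfld (q k : nat) : pred F := [pred x : F | x ^+ (q ^ k) == x].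

(* x^{q^m} for an integer exponent m, computed modulo x^{q^N} - x
   (N = 2n, so that x^{q^N} = x on F = F_{q^{2n}}): the exponent m is reduced mod N. *)
Definition qpow (q N : nat) (m : int) (x : F) : F :=
  x ^+ (q ^ `|(m %% N%:Z)%Z|%N).

Definition normqn (q n : nat) (x : F) : F := x ^+ ((q ^ (2 * n) - 1) %/ (q - 1)).

Definition indepK (K : pred F) (r : nat) (v : {ffun 'I_r -> F}) : bool :=
  [forall c : {ffun 'I_r -> F},
     ([forall i, c i \in K] && (\sum_i c i * v i == 0)) ==> [forall i, c i == 0]].

(* Rank of f : F -> F over K: the K-dimension of its image, i.e. the maximal
   size of a K-linearly independent family in the image (such families have
   distinct nonzero members, so their size is at most #|F|). *)
Definition rankK (K : pred F) (f : {ffun F -> F}) : nat :=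
  \max_(r < #|F|.+1 | [exists v : {ffun 'I_r -> F},
                          [forall i, v i \in codom f] && indepK K r v]) r.

(* The linearized polynomial of the family H~_s with parameters a, b, c,
   as a function F -> F (n odd, m = (n-3)/2, c_i indexed by i : 'I_m standing for i+1). *)
Definition Hpoly (q n : nat) (s : int) (gam a b : F) (c : {ffun 'I_((n - 3)./2) -> F})
  (x : F) : F :=
  let N := (2 * n)%N in
  b * qpow q N (2 * s * ((n + 1)./2)%:Z) x
  + a * gam * qpow q N (2 * s * ((n - 1)./2)%:Z) x
  + qpow q N (s * (n + 2)%:Z) (a * gam) * qpow q N (2 * s * ((n + 3)./2)%:Z) x
  + \sum_(i < (n - 3)./2)
      (c i * qpow q N (2 * s * (i.+1)%:Z) x
       + qpow q N (s * (2 * n - 2 * i.+1 + 1)%:Z) (c i)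
           * qpow q N (2 * s * (n - i.+1 + 1)%:Z) x).

Definition Hcode (q n : nat) (s : int) (gam : F) : {set {ffun F -> F}} :=
  [set f : {ffun F -> F} | [exists a : F, [exists b : F,
     [exists c : {ffun 'I_((n - 3)./2) -> F},
       [&& a \in subfld q n, b \in subfld q n & f == [ffun x => Hpoly q n s gam a b c x]]]]]].

End Defs.

Arguments subfld {F} q k.
Arguments qpow {F} q N m x.
Arguments normqn {F} q n x.
Arguments indepK {F} K r v.
Arguments rankK {F} K f.
Arguments Hpoly {F} q n s gam a b c x.
Arguments Hcode {F} q n s gam.

(* Main.v *)
Require Import Defs.
From HB Require Import structures.
From mathcomp Require Import all_boot all_order all_algebra all_field.
From mathcomp Require Import ring zify.
Import GRing.Theory.
Local Open Scope ring_scope.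

(* Write N for the norm from F = F_{q^(2n)} to F_q and tau(x) = x^(q^(2s)), a
   generator of Gal(F / F_{q^2}).  The exponents of a codeword run once through
   the classes 1, ..., n modulo n, so f = sum_(k < n) g_k tau^(k+1), where the
   g_k are determined by f because distinct powers of tau are linearly
   independent.  If f has rank at most 1 and alpha is a nonzero value of f, then
   f / alpha takes values in F_{q^2}, hence is fixed by tau; comparing
   coefficients gives g_(k+1) / alpha = tau(g_k / alpha), so all the g_k have the
   same norm.  Applied to the two adjacent coefficients a * gam and b this gives
   N(a) N(gam) = N(b) with a, b nonzero.  An element of F_{q^n} has square norm,
   since N(y) = N_{q^n/q}(y)^2, so N(gam) would be a square. *)

(** * Powers of the Frobenius map and subfields of F *)

Section LinearizedPolynomials.
Variables (F : finFieldType) (q N : nat).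
Hypotheses (pcharq : [pchar F].-nat q) (N_gt0 : (0 < N)%N).
Hypothesis cardF : #|F| = (q ^ N)%N.

Lemma base_gt1 : (1 < q)%N.
Proof.
have := finNzRing_gt1 F; rewrite cardF; case: q => [|[|//]].
  by rewrite exp0n.
by rewrite exp1n.
Qed.

Lemma expqD m (x y : F) :
  (x + y) ^+ (q ^ m) = x ^+ (q ^ m) + y ^+ (q ^ m).
Proof. by apply: exprDn_pchar; rewrite pnatX pcharq. Qed.

Lemma expq_mod m (x : F) : x ^+ (q ^ (m %% N)) = x ^+ (q ^ m).
Proof.
rewrite {2}(divn_eq m N); elim: (m %/ N)%N => [|d IHd]; first by rewrite mul0n.
by rewrite mulSn -addnA expnD exprM -cardF expf_card.
Qed.

Lemma qpow_nat m (x : F) : qpow q N m%:Z x = x ^+ (q ^ m).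
Proof. by rewrite /qpow modz_nat absz_nat expq_mod. Qed.

Lemma qpow_eqmod m m' (x : F) :
  (m = m' %[mod N%:Z])%Z -> qpow q N m x = qpow q N m' x.
Proof. by rewrite /qpow => ->. Qed.

(** The exponent in [qpow] is the absolute value of a residue; the residue is nonnegative, so
    integer congruences can be applied to it. *)
Lemma modz_absz (m : int) : (m %% N%:Z)%Z = `|(m %% N%:Z)%Z|%N%:Z.
Proof. by rewrite gez0_abs // modz_ge0 // -lt0n. Qed.

Lemma qpowE m (x : F) : qpow q N m x = x ^+ (q ^ `|(m %% N%:Z)%Z|).
Proof. by []. Qed.

Lemma qpow_comp m m' (x : F) : qpow q N m (qpow q N m' x) = qpow q N (m + m') x.
Proof.
rewrite !qpowE -exprM -expnD -qpow_nat PoszD -!modz_absz.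
by rewrite addrC -qpowE; apply: qpow_eqmod; rewrite modzDm.
Qed.

Lemma qpowD m (x y : F) : qpow q N m (x + y) = qpow q N m x + qpow q N m y.
Proof. exact: expqD. Qed.

Lemma qpowM m (x y : F) : qpow q N m (x * y) = qpow q N m x * qpow q N m y.
Proof. exact: exprMn. Qed.

Lemma qpow_eq0 m (x : F) : (qpow q N m x == 0) = (x == 0).
Proof. by rewrite qpowE expf_eq0 expn_gt0 (ltnW base_gt1). Qed.

Lemma qpow0 m : qpow q N m (0 : F) = 0.
Proof. by apply/eqP; rewrite qpow_eq0. Qed.

Lemma qpow_sum m (I : Type) (r : seq I) (f : I -> F) :
  qpow q N m (\sum_(i <- r) f i) = \sum_(i <- r) qpow q N m (f i).
Proof. exact: (big_morph _ (qpowD m) (qpow0 m)). Qed.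

Lemma subfld_expq k m (x : F) : x \in subfld q k -> x ^+ (q ^ (k * m)) = x.
Proof.
rewrite inE => /eqP xK; elim: m => [|m IHm]; first by rewrite muln0 expr1.
by rewrite mulnS expnD exprM xK.
Qed.

Lemma subfldD k (x y : F) :
  x \in subfld q k -> y \in subfld q k -> x + y \in subfld q k.
Proof. by rewrite !inE expqD => /eqP-> /eqP->. Qed.

Lemma subfldM k (x y : F) :
  x \in subfld q k -> y \in subfld q k -> x * y \in subfld q k.
Proof. by rewrite !inE exprMn => /eqP-> /eqP->. Qed.

Lemma subfld1_qpow m (x : F) : x \in subfld q 1 -> qpow q N m x = x.
Proof. by move=> xK; rewrite qpowE -[X in (q ^ X)%N]mul1n subfld_expq. Qed.

Lemma subfld1_sub k (x : F) : x \in subfld q 1 -> x \in subfld q k.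
Proof. by move=> xK; rewrite inE -[k]mul1n subfld_expq. Qed.

(** Monomials with distinct exponents [q ^ e k] below [q ^ N] add up to a polynomial of degree less
    than [#|F|]. If it vanishes on all of F it has too many roots, so its coefficients are zero. *)
Lemma monomials_free (r : nat) (e : 'I_r -> nat) (g : 'I_r -> F) :
  injective e -> (forall k, (e k < N)%N) ->
  (forall x, \sum_k g k * x ^+ (q ^ e k) = 0) -> forall k, g k = 0.
Proof.
move=> e_inj e_lt g0 k.
pose P := \sum_k g k *: 'X^(q ^ e k).
have sP : (size P <= #|F|)%N.
  apply: leq_trans (size_sum _ _ _) _; apply/bigmax_leqP => i _.
  apply: leq_trans (size_scale_leq _ _) _.
  by rewrite size_polyXn cardF ltn_exp2l ?base_gt1.
have P0 : P = 0.
  apply/eqP/negP => /negP P_neq0.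
  suff: (size (enum F) < size P)%N by rewrite -cardE ltnNge sP.
  apply: max_poly_roots => //; last exact: enum_uniq.
  apply/allP => x _.
  rewrite /root horner_sum -[X in _ == X](g0 x); apply/eqP.
  by apply: eq_bigr => i _; rewrite hornerZ hornerXn.
have := congr1 (fun p : {poly F} => p`_(q ^ e k)) P0.
rewrite coef0 coef_sum (bigD1 k) //= big1 ?addr0.
  by rewrite coefZ coefXn eqxx mulr1.
move=> i ik; rewrite coefZ coefXn eqn_exp2l ?base_gt1 // eq_sym.
by rewrite (inj_eq e_inj) (negPf ik) mulr0.
Qed.

(* 'X^(q ^ k) - 'X divides 'X^#|F| - 'X, which splits with simple roots in F. *)
Lemma card_subfld k : (0 < k)%N -> (k %| N)%N ->
  #|[pred x : F | x \in subfld q k]| = (q ^ k)%N.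
Proof.
move=> k_gt0 /dvdnP[d Nd].
pose P : {poly F} := 'X^(q ^ k) - 'X.
have sP : size P = (q ^ k).+1.
  rewrite size_polyDl size_polyXn // size_polyN size_polyX !ltnS.
  by rewrite -[X in (X < _)%N](expn0 q) ltn_exp2l ?base_gt1.
have PX : forall e, P %| 'X^(q ^ (e * k)) - 'X.
  elim=> [|e IHe]; first by rewrite mul0n expn0 expr1 subrr dvdp0.
  have -> : 'X^(q ^ (e.+1 * k)) - 'X
      = ('X^(q ^ (e * k)) - 'X) ^+ (q ^ k) + P :> {poly F}.
    have qP : [pchar {poly F}].-nat (q ^ k)%N.
      by rewrite pnatX (eq_pnat _ (pchar_poly F)) pcharq.
    rewrite exprDn_pchar // exprNn_pchar //.
    by rewrite -exprM -expnD mulSn addnC /P addrA subrK.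
  by rewrite dvdp_addl ?dvdpp // dvdp_exp ?expn_gt0 ?(ltnW base_gt1).
have := PX d; rewrite -Nd -cardF finField_genPoly.
case/dvdp_prod_XsubC => m Pm.
set r := mask m _ in Pm.
have r_uniq : uniq r by rewrite mask_uniq // index_enum_uniq.
have rE : r =i subfld q k.
  move=> x; rewrite -root_prod_XsubC -(eqp_root Pm) inE.
  by rewrite /root !hornerE subr_eq0.
have := eqp_size Pm; rewrite sP size_prod_XsubC => -[->].
by rewrite -(card_uniqP r_uniq); apply: eq_card => x; rewrite inE rE.
Qed.

End LinearizedPolynomials.

(** * The norm from F to F_q *)

Section Norm.
Variables (F : finFieldType) (q n : nat).
Hypotheses (q_gt1 : (1 < q)%N) (n_gt0 : (0 < n)%N).
Hypothesis cardF : #|F| = (q ^ (2 * n))%N.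

Lemma divn_predXK m : ((q ^ m - 1) %/ (q - 1) * (q - 1) = q ^ m - 1)%N.
Proof. by apply: divnK; rewrite !subn1 dvdn_pred_predX. Qed.

Lemma divn_predX_gt0 m : (0 < m)%N -> (0 < (q ^ m - 1) %/ (q - 1))%N.
Proof.
move=> m_gt0; rewrite divn_gt0 ?subn_gt0 //.
by rewrite leq_sub2r // -[X in (X <= _)%N]expn1 leq_exp2l.
Qed.

(** This power is the norm from F_{q^m} to F_q: for nonzero x its (q-1)-st power is x^(q^m - 1) =
    1. *)
Lemma expr_divn_predX_fixed m (x : F) : (0 < m)%N -> x \in subfld q m ->
  x ^+ ((q ^ m - 1) %/ (q - 1)) \in subfld q 1.
Proof.
move=> m_gt0; rewrite !inE => /eqP xm; have [->|x0] := eqVneq x 0.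
  by rewrite expn1 [0 ^+ (_ %/ _)]expr0n eqn0Ngt divn_predX_gt0 // expr0n eqn0Ngt ltnW.
rewrite -exprM expn1 -[X in (_ * X)%N](subnK (ltnW q_gt1)) mulnDr muln1.
rewrite divn_predXK exprD; apply/eqP.
have -> : x ^+ (q ^ m - 1) = 1.
  apply: (mulIf x0); rewrite -exprSr subn1 prednK ?expn_gt0 ?(ltnW q_gt1) //.
  by rewrite mul1r.
by rewrite mul1r.
Qed.

Lemma normqnM (x y : F) : normqn q n (x * y) = normqn q n x * normqn q n y.
Proof. exact: exprMn. Qed.

Lemma normqn_eq0 (x : F) : (normqn q n x == 0) = (x == 0).
Proof. by rewrite /normqn expf_eq0 divn_predX_gt0 // muln_gt0. Qed.

(** Once the exponents are swapped, the Frobenius power acts on the norm of x, which lies in F_q and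
    is fixed. *)
Lemma normqn_qpow m (x : F) : normqn q n (qpow q (2 * n) m x) = normqn q n x.
Proof.
rewrite /normqn /qpow -exprM mulnC exprM -[`|_|%N]mul1n.
apply: subfld_expq; apply: expr_divn_predX_fixed; first by rewrite muln_gt0.
by rewrite inE -cardF expf_card.
Qed.

Lemma normqn_sqr (x : F) : x \in subfld q n ->
  exists2 y, y \in subfld q 1 & normqn q n x = y ^+ 2.
Proof.
move=> xK; have yK := expr_divn_predX_fixed n x n_gt0 xK; eexists; first exact: yK.
rewrite /normqn.
(* With y the norm of x from F_{q^n} to F_q, this factorization gives N(x) = y^(q^n) * y, and
   y^(q^n) = y. *)
have -> : ((q ^ (2 * n) - 1) %/ (q - 1)
    = (q ^ n).+1 * ((q ^ n - 1) %/ (q - 1)))%N.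
  apply/eqP; rewrite -(@eqn_pmul2r (q - 1)) ?subn_gt0 // -mulnA !divn_predXK.
  by rewrite mulnC expnM -[X in (_ - X)%N](exp1n 2) subn_sqr addn1 mulnC.
rewrite mulnC exprM exprSr expr2; congr (_ * _).
by move: yK; set y := x ^+ _ => yK; rewrite -[n]mul1n subfld_expq.
Qed.

End Norm.

(** If the quotient were outside the subfield, [f x] and [f y] would be independent: a relation with
    a nonzero coefficient at [f y] expresses the quotient by subfield elements. *)
Lemma rankK_lt2 (F : finFieldType) (q k : nat) (f : {ffun F -> F}) (x y : F) :
  [pchar F].-nat q ->
  (rankK (subfld q k) f < 2)%N -> f x != 0 -> f y / f x \in subfld q k.
Proof.
move=> pcharq + fx0; apply: contraLR => yxK; rewrite -leqNgt /rankK.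
(* [rankK] only ranges over families of size at most [#|F|], so size 2 has to be admissible. *)
have F_gt1 : (2 < #|F|.+1)%N by rewrite ltnS finNzRing_gt1.
apply: (leq_bigmax_cond (Ordinal F_gt1)).
apply/existsP; exists [ffun i : 'I_2 => if i == 0 then f x else f y].
apply/andP; split; first by apply/forallP => i; rewrite ffunE; case: ifP; rewrite codom_f.
apply/forallP => c; apply/implyP => /andP[/forallP cK].
rewrite big_ord_recl big_ord1 !ffunE /= => /eqP c0.
suff c1 : c (lift ord0 ord0) = 0.
  move: c0; rewrite c1 mul0r addr0 => /eqP; rewrite mulf_eq0 (negPf fx0) orbF => c0.
  by apply/forallP => i; case: (unliftP ord0 i) => [j|] ->; rewrite ?ord1 ?c1.
apply/eqP; apply: contraNT yxK => c1.
have -> : f y / f x = - (c ord0 / c (lift ord0 ord0)).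
  have -> : f y = - (c ord0 * f x) / c (lift ord0 ord0).
    by rewrite (addr0_eq c0) mulrC mulKf.
  by field; rewrite c1.
rewrite inE exprNn_pchar ?pnatX ?pcharq // exprMn exprVn.
by move: (cK ord0) (cK (lift ord0 ord0)); rewrite !inE => /eqP-> /eqP->.
Qed.

(** Brings a sum over the powers of tau into the order of [Hpoly]: three middle terms, then the
    first m indices paired with the last m in reverse. *)
Lemma sum_mid_pairs (V : nmodType) (n m : nat) (G : nat -> V) : n = (m + 3 + m)%N ->
  \sum_(k < n) G k
    = G m.+1 + G m + G m.+2 + \sum_(i < m) (G i + G (n - i.+1)%N).
Proof.
move=> nE; rewrite -(big_mkord xpredT) (@big_cat_nat _ _ _ (m + 3)) //=; last lia.
rewrite (@big_cat_nat _ _ _ m 0 (m + 3)) //=; last lia.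
rewrite big_split /= -(big_mkord xpredT G).
rewrite -{2}[(m + 3)%N]add0n big_addn.
have -> : \sum_(m <= i < m + 3) G i = G m.+1 + G m + G m.+2.
  by rewrite addn3 !big_nat_recl ?big_geq //; try lia; rewrite addr0 addrA [G m + _]addrC.
rewrite -addrA addrCA; congr (_ + (_ + _)).
have -> : (n - (m + 3) = m)%N by lia.
by rewrite big_nat_rev big_mkord; apply: eq_bigr => i _; congr G; have := ltn_ord i; lia.
Qed.

(** * Combinations of powers of tau, and those with values in F_{q^2} *)

Section Linpoly.
Variables (F : finFieldType) (q n : nat) (s : int).
Hypotheses (pcharq : [pchar F].-nat q) (n_gt0 : (0 < n)%N).
Hypothesis cardF : #|F| = (q ^ (2 * n))%N.
Hypothesis gcd_s : gcdz s (2 * n)%:Z = 1.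

(** The powers are tau, ..., tau^n, the last one being the identity; this matches the exponents of
    [Hpoly]. *)
Definition linpoly (g : nat -> F) (x : F) : F :=
  \sum_(k < n) g k * qpow q (2 * n) (2 * s * k.+1%:Z) x.

Let N_gt0 : (0 < 2 * n)%N. Proof. by rewrite muln_gt0. Qed.
Let N_neq0 : (2 * n)%:Z != 0. Proof. by rewrite -lt0n. Qed.

(** As s is coprime to n, the exponents 2s(k+1) with k < n are distinct modulo 2n, and
    [monomials_free] applies. *)
Lemma linpoly_free (g : nat -> F) :
  (forall x, linpoly g x = 0) -> forall k, (k < n)%N -> g k = 0.
Proof.
move=> g0 k kn.
pose e (i : 'I_n) := `|((2 * s * i.+1%:Z) %% (2 * n)%:Z)%Z|%N.
apply: (@monomials_free F q (2 * n) N_gt0 cardF n e (fun i => g i) _ _ _ (Ordinal kn)).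
- move=> i j; rewrite /e => /(congr1 Posz); rewrite -!modz_absz // => /eqP.
  rewrite eqz_mod_dvd -mulrBr PoszM -mulrA dvdz_mul2l //= Gauss_dvdzr; last first.
    have : coprimez s (2 * n)%:Z by rewrite /coprimez gcd_s.
    by rewrite PoszM coprimezMr => /andP[_]; rewrite coprimez_sym.
  move=> ij; apply/val_inj/eqP; move: ij.
  rewrite -eqz_mod_dvd -[i.+1]addn1 -[j.+1]addn1 !PoszD eqz_modDr.
 by rewrite !modz_small ?ltz_nat ?ltn_ord.
- by move=> i; rewrite /e -ltz_nat -modz_absz // ltz_pmod.
- exact: g0.
Qed.

Lemma qpow_subfld2 (t : F) : t \in subfld q 2 -> qpow q (2 * n) (2 * s) t = t.
Proof.
(* Modulo 2n, 2s is twice the residue of s modulo n, so tau is an iterate of the q^2-power map. *)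
move=> tK; rewrite (@qpow_eqmod _ _ _ _ (2 * `|(s %% n%:Z)%Z|)%N%:Z).
  by rewrite qpow_nat // subfld_expq.
rewrite [(2 * `|_|)%N%:Z]PoszM -modz_absz // {1}(divz_eq s n).
by rewrite mulrDr mulrCA -PoszM modzMDl.
Qed.

Lemma linpoly_subfld2 (u : nat -> F) : (forall x, linpoly u x \in subfld q 2) ->
  forall k, (k.+1 < n)%N -> u k.+1 = qpow q (2 * n) (2 * s) (u k).
Proof.
move=> uK k kn; pose tau := qpow q (2 * n) (2 * s) : F -> F.
(* Coefficients of tau composed with [linpoly u]: a cyclic shift, the last term wrapping round
   because tau^(n+1) = tau. *)
pose h k := if k is j.+1 then tau (u j) else tau (u n.-1).
have hE x : linpoly h x = linpoly u x.
  have sumS (G : nat -> F) : \sum_(k < n) G k = G 0%N + \sum_(k < n.-1) G k.+1.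
    by rewrite -[in LHS](prednK n_gt0) big_ord_recl.
  have sumSr (G : nat -> F) : \sum_(k < n) G k = G n.-1 + \sum_(k < n.-1) G k.
    by rewrite -[in LHS](prednK n_gt0) big_ord_recr addrC.
  rewrite -[RHS]qpow_subfld2 // /linpoly qpow_sum //.
  rewrite (sumS (fun k => h k * qpow q (2 * n) (2 * s * k.+1%:Z) x)).
  rewrite (sumSr (fun k => qpow q (2 * n) (2 * s)
     (u k * qpow q (2 * n) (2 * s * k.+1%:Z) x))) /=.
  congr (_ + _).
    rewrite qpowM qpow_comp // prednK //; congr (_ * _); apply: qpow_eqmod.
    have -> : 2 * s + 2 * s * n%:Z = s * (2 * n)%:Z + 2 * s * 1.
      by rewrite PoszM; ring.
    by rewrite modzMDl.
  apply: eq_bigr => i _; rewrite qpowM qpow_comp //; congr (_ * qpow _ _ _ _).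
  by rewrite [i.+2%:Z]intS mulrDr mulr1.
suff /eqP : u k.+1 - h k.+1 = 0 by rewrite subr_eq0 => /eqP.
apply: (@linpoly_free (fun k => u k - h k)) => // x; rewrite /linpoly.
under eq_bigr do rewrite mulrBl.
by rewrite sumrB; apply/eqP; rewrite subr_eq0; apply/eqP/esym/hE.
Qed.

End Linpoly.

(** * Codewords and their coefficients *)

Section Hermitian.
Variables (F : finFieldType) (q n : nat) (s : int) (gam : F).
Hypotheses (pcharq : [pchar F].-nat q) (n_ge3 : (3 <= n)%N) (n_odd : odd n).
Hypothesis cardF : #|F| = (q ^ (2 * n))%N.
Hypothesis gcd_s : gcdz s (2 * n)%:Z = 1.

Local Notation m := ((n - 3)./2).
Local Notation N := (2 * n)%N.

Let n_gt0 : (0 < n)%N. Proof. exact: leq_trans n_ge3. Qed.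
Let N_gt0 : (0 < N)%N. Proof. by rewrite muln_gt0. Qed.
Let nE : n = (m + 3 + m)%N. Proof. lia. Qed.

(* Coefficient of tau^(k+1); in this numbering the involution i |-> n + 1 - i of
   the exponents becomes k |-> n - k.+1. *)
Definition Hcoef (a b : F) (c : {ffun 'I_m -> F}) (k : nat) : F :=
  if (insub k : option 'I_m) is Some i then c i
  else if k == m then a * gam
  else if k == m.+1 then b
  else if k == m.+2 then qpow q N (s * (n + 2)%:Z) (a * gam)
  else if (insub (n - k.+1)%N : option 'I_m) is Some i
    then qpow q N (s * (2 * n - 2 * i.+1 + 1)%:Z) (c i)
  else 0.

Lemma Hpoly_linpoly a b c x :
  Hpoly q n s gam a b c x = linpoly F q n s (Hcoef a b c) x.
Proof.
rewrite /linpoly.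
rewrite (sum_mid_pairs _ _ m (fun k => Hcoef a b c k * qpow q N (2 * s * k.+1%:Z) x)) //.
have out k : (m <= k)%N -> insub k = None :> option 'I_m.
  by move=> mk; rewrite insubF // ltnNge mk.
rewrite /Hcoef /Hpoly !out ?eqxx //; try lia.
rewrite !(gtn_eqF (ltnSn _)) (gtn_eqF (leqnSn m.+1)).
have -> : ((n + 1)./2 = m.+2)%N by lia.
have -> : ((n - 1)./2 = m.+1)%N by lia.
have -> : ((n + 3)./2 = m.+3)%N by lia.
congr (_ + _); apply: eq_bigr => i _; rewrite valK out; last first.
  by have := ltn_ord i; lia.
(* Reflecting the index [n - i.+1] gives back i, so the last branch of [Hcoef] selects the conjugate
   of [c i]. *)
have -> : (n - (n - i.+1).+1 = i)%N by have := ltn_ord i; lia.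
rewrite valK !ifN_eq; try by have := ltn_ord i; lia.
by rewrite (addn1 (n - i.+1)).
Qed.

Lemma Hcoef_mid_a a b c : Hcoef a b c m = a * gam.
Proof. by rewrite /Hcoef insubF ?ltnn // eqxx. Qed.

Lemma Hcoef_mid_b a b c : Hcoef a b c m.+1 = b.
Proof.
by rewrite /Hcoef insubF ?ltnNge ?leqnSn // -[X in _ == X]addn0 -addn1 eqn_add2l eqxx.
Qed.

Lemma Hcoef_lt a b c (i : 'I_m) : Hcoef a b c i = c i.
Proof. by rewrite /Hcoef valK. Qed.

Lemma HcodeP (f : {ffun F -> F}) :
  reflect (exists a b c, [/\ a \in subfld q n, b \in subfld q n
            & f = [ffun x => Hpoly q n s gam a b c x]])
          (f \in Hcode q n s gam).
Proof.
rewrite inE; apply: (iffP existsP).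
  by move=> [a /existsP[b /existsP[c /and3P[aK bK /eqP fE]]]]; exists a, b, c.
move=> [a [b [c [aK bK ->]]]]; exists a; apply/existsP; exists b.
by apply/existsP; exists c; rewrite aK bK eqxx.
Qed.

(** * Linearity over F_q and size of the code *)

Lemma HpolyD a b (c : {ffun 'I_m -> F}) a' b' (c' : {ffun 'I_m -> F}) x :
  Hpoly q n s gam (a + a') (b + b') [ffun i => c i + c' i] x
    = Hpoly q n s gam a b c x + Hpoly q n s gam a' b' c' x.
Proof.
rewrite /Hpoly [RHS]addrACA -big_split; congr (_ + _).
  by rewrite [(a + a') * gam]mulrDl qpowD //; ring.
by apply: eq_bigr => i _; rewrite ffunE qpowD //=; ring.
Qed.

(** Elements of F_q are fixed by every [qpow], so they also factor out of the conjugated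
    coefficients. *)
Lemma HpolyZ k a b (c : {ffun 'I_m -> F}) x : k \in subfld q 1 ->
  Hpoly q n s gam (k * a) (k * b) [ffun i => k * c i] x
    = k * Hpoly q n s gam a b c x.
Proof.
move=> kK; rewrite /Hpoly mulrDr mulr_sumr; congr (_ + _).
  rewrite -[k * a * gam]mulrA [qpow _ _ _ (k * _)]qpowM.
  by rewrite (subfld1_qpow _ _ _ _ k) //; ring.
by apply: eq_bigr => i _; rewrite ffunE qpowM (subfld1_qpow _ _ _ _ k) //; ring.
Qed.

(** Makes counting codewords the same as counting parameters, which are read off from the
    coefficients at m, m+1 and the indices below m. *)
Lemma Hpoly_inj a b c a' b' c' : gam != 0 ->
  [ffun x => Hpoly q n s gam a b c x] = [ffun x => Hpoly q n s gam a' b' c' x]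
  -> [/\ a = a', b = b' & c = c'].
Proof.
move=> gam0 /ffunP eqH.
have eqcoef k : (k < n)%N -> Hcoef a b c k = Hcoef a' b' c' k.
  move=> kn; apply/eqP; rewrite -subr_eq0; apply/eqP.
  apply: (linpoly_free _ _ _ s n_gt0 cardF gcd_s
            (fun k => Hcoef a b c k - Hcoef a' b' c' k)) => // x.
  have := eqH x; rewrite !ffunE !Hpoly_linpoly => /eqP.
  rewrite -subr_eq0 => /eqP <-; rewrite /linpoly -sumrB.
  by apply: eq_bigr => i _; rewrite mulrBl.
split; last apply/ffunP => i.
- by have := eqcoef m; rewrite !Hcoef_mid_a => eqa; apply: (mulIf gam0); apply: eqa; lia.
- by have := eqcoef m.+1; rewrite !Hcoef_mid_b; apply; lia.
- have := eqcoef i; rewrite !Hcoef_lt; apply.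
  by have := ltn_ord i; lia.
Qed.

Lemma card_Hcode : gam != 0 -> #|Hcode q n s gam| = (q ^ (n * (n - 1)))%N.
Proof.
move=> gam0; pose A := [set x : F | x \in subfld q n].
pose G (t : F * F * {ffun 'I_m -> F}) := [ffun x => Hpoly q n s gam t.1.1 t.1.2 t.2 x].
have -> : Hcode q n s gam = G @: setX (setX A A) setT.
  apply/setP => f; apply/HcodeP/imsetP.
    move=> [a [b [c [aK bK ->]]]]; exists (a, b, c) => //.
    by rewrite !inE in aK bK *; rewrite aK bK.
  move=> [[[a b] c]]; rewrite !inE /= andbT => /andP[aK bK] ->.
  by exists a, b, c; rewrite !inE.
rewrite card_imset; last first.
  by move=> [[a b] c] [[a' b'] c'] /(Hpoly_inj _ _ _ _ _ _ gam0) /= [-> -> ->].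
rewrite !cardsX cardsT card_ffun card_ord cardF cardsE.
rewrite (card_subfld F q N) // ?dvdn_mull // -expnM -!expnD; congr (q ^ _)%N.
(* The exponent is n + n + 2nm, which equals n(n-1) because n = 2m + 3. *)
nia.
Qed.

(** * Rank of the nonzero codewords *)

Lemma Hcode_rank a b c : a \in subfld q n -> b \in subfld q n ->
  ~ (exists y : F, y \in subfld q 1 /\ y ^+ 2 = normqn q n gam) ->
  let f := [ffun x => Hpoly q n s gam a b c x] in
  f != [ffun => 0] -> (2 <= rankK (subfld q 2) f)%N.
Proof.
move=> aK bK nsq f f_neq0; rewrite leqNgt; apply/negP => rk.
have q1 := base_gt1 F q N N_gt0 cardF.
have [x0 fx0] : exists x0, f x0 != 0.
  apply/existsP; apply: contraNT f_neq0 => /existsPn f0.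
  by apply/eqP/ffunP => x; rewrite [RHS]ffunE; apply/eqP/negPn/f0.
pose u k := Hcoef a b c k / f x0.
have uE x : linpoly F q n s u x = f x / f x0.
  rewrite [f x]ffunE Hpoly_linpoly /linpoly mulr_suml.
  by apply: eq_bigr => i _; rewrite mulrAC.
have uK x : linpoly F q n s u x \in subfld q 2.
  by rewrite uE; apply: rankK_lt2.
have uS k : (k.+1 < n)%N -> u k.+1 = qpow q N (2 * s) (u k).
  exact: linpoly_subfld2.
(* The indices m and m+1 are adjacent, and the common factor N(1 / f x0) cancels. *)
have Nab : normqn q n (a * gam) = normqn q n b.
  have := uS m; rewrite /u Hcoef_mid_a Hcoef_mid_b => /(_ _)/(congr1 (normqn q n)).
  rewrite normqn_qpow // !normqnM => eqN.
  apply/esym/(mulIf _ (eqN _)); last lia.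
  by rewrite normqn_eq0 // invr_eq0.
have a0 : a != 0.
  apply: contraNneq f_neq0 => a0; apply/eqP/ffunP => x.
  have um : u m = 0 by rewrite /u Hcoef_mid_a a0 !mul0r.
  have u0 k : (k < n)%N -> u k = 0.
    (* Since tau maps only 0 to 0, one vanishing coefficient makes all of them vanish, hence f as
       well. *)
    have u00 j : (j < n)%N -> (u j == 0) = (u 0%N == 0).
      elim: j => // j IHj jn; rewrite uS // qpow_eq0 //; exact/IHj/ltnW.
    by move=> kn; apply/eqP; rewrite u00 // -(u00 m) ?um //; lia.
  have := uE x; rewrite /linpoly big1 => [/esym/eqP|i _]; last by rewrite u0 ?mul0r.
  by rewrite mulf_eq0 invr_eq0 (negPf fx0) orbF [RHS]ffunE => /eqP.
have [ya yaK Na] := normqn_sqr F q n q1 n_gt0 a aK.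
have [yb ybK Nb] := normqn_sqr F q n q1 n_gt0 b bK.
have ya0 : ya != 0 by rewrite -sqrf_eq0 -Na normqn_eq0.
(* The square of [yb / ya] is N(b) / N(a) = N(gam). *)
apply: nsq; exists (yb / ya); split.
  by move: yaK ybK; rewrite !inE exprMn exprVn => /eqP-> /eqP->.
by rewrite expr_div_n -Nb -Nab -Na normqnM mulrC mulKf // normqn_eq0.
Qed.

End Hermitian.

Theorem theorem6p2 (F : finFieldType) (q n : nat) (s : int) (gam : F) :
  (exists p k : nat, [/\ prime p, (0 < k)%N & q = (p ^ k)%N]) ->
  odd q ->
  (3 <= n)%N -> odd n ->
  (gcdz s (2 * n)%:Z = 1)%N ->
  #|F| = (q ^ (2 * n))%N ->
  ~ (exists y : F, y \in subfld q 1 /\ y ^+ 2 = normqn q n gam) ->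
  let H := Hcode q n s gam in
  [/\ (forall f g, f \in H -> g \in H -> [ffun x => f x + g x] \in H),
      (forall (k : F) f, k \in subfld q 1 -> f \in H -> [ffun x => k * f x] \in H),
      #|H| = (q ^ (n * (n - 1)))%N
    & forall f, f \in H -> f != [ffun => 0] -> (2 <= rankK (subfld q 2) f)%N].
Proof.
move=> [p [e [p_prime e_gt0 qE]]] _ n_ge3 n_odd gcd_s cardF nsq H.
have pcharq : [pchar F].-nat q.
  rewrite qE pnatX; apply/orP; left; rewrite pnatE //.
  apply: (card_finPcharP (n := (e * (2 * n))%N)) => //.
  by rewrite cardF qE -expnM.
(* N(0) = 0 is the square of 0, so the non-square hypothesis excludes gam = 0. *)
have gam0 : gam != 0.
  apply: contra_notN nsq => /eqP ->; exists 0; split.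
    by rewrite inE expn1 expr0n qE expn_eq0 eqn0Ngt prime_gt0.
  apply/esym/eqP; rewrite expr0n /= normqn_eq0 //; last lia.
  by apply: (base_gt1 F q (2 * n)) => //; lia.
split.
- move=> _ _ /HcodeP[a [b [c [aK bK ->]]]] /HcodeP[a' [b' [c' [aK' bK' ->]]]].
  apply/HcodeP; exists (a + a'), (b + b'), [ffun i => c i + c' i].
  split; [exact: subfldD|exact: subfldD|].
  by apply/ffunP => x; rewrite !ffunE HpolyD.
- move=> k _ kK /HcodeP[a [b [c [aK bK ->]]]].
  apply/HcodeP; exists (k * a), (k * b), [ffun i => k * c i].
  have kKn := subfld1_sub F q n k kK.
  split; [exact: subfldM|exact: subfldM|].
  by apply/ffunP => x; rewrite !ffunE HpolyZ.
- exact: card_Hcode.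
- move=> _ /HcodeP[a [b [c [aK bK ->]]]]; exact: Hcode_rank.
Qed.
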